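(* $\mathrm{Th}(\textsc{Lreg}\varepsilon\text{-models};\backslash,\wedge,\mathbf{1})\neq\mathrm{Th}(\text{L}\varepsilon\text{-models};\backslash,\wedge,\mathbf{1})$.
   Context: Formulae are built from a countable set of variables and the constant $\mathbf{1}$ by the binary connectives $\backslash$ and $\wedge$. Sequents are $\Gamma\vdash C$ with $\Gamma$ a finite, possibly empty, sequence of formulae and $C$ a formula. An L$\varepsilon$-model over an alphabet (set) $\Sigma$ is a map $w$ from formulae to subsets of $\Sigma^*$ with $w(A\backslash B)=\{u\in\Sigma^*\mid \forall v\in w(A)\; vu\in w(B)\}$, $w(A\wedge B)=w(A)\cap w(B)$, $w(\mathbf{1})=\{\varepsilon\}$ ($\varepsilon$ is the empty word); values on variables are arbitrary. A sequent $A_1,\dots,A_n\vdash B$ ($n\ge1$) is true in $w$ if $w(A_1)\cdots w(A_n)\subseteq w(B)$ (elementwise concatenation); $\vdash B$ is true if $\varepsilon\in w(B)$. An $\textsc{Lreg}\varepsilon$-model is an L$\varepsilon$-model over a finite alphabet in which every variable is interpreted by a regular language, i.e. one described by a regular expression built from letters, $0$ (the empty language) and $1$ (the language $\{\varepsilon\}$) using product, union and Kleene star. For a class $\mathcal{K}$ of models, $\mathrm{Th}(\mathcal{K};\backslash,\wedge,\mathbf{1})$ is the set of all sequents in the language of $\backslash,\wedge,\mathbf{1}$ that are true in all models from $\mathcal{K}$. *)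

(* Defs.v *)
From mathcomp Require Import all_boot.
From mathcomp Require Import boolp classical_sets cardinality.

Set Implicit Arguments.
Unset Strict Implicit.
Unset Printing Implicit Defensive.

Local Open Scope classical_set_scope.

Inductive formula : Type :=
| Var of nat
| One
| LDiv of formula & formula  (* [LDiv A B] is A \ B *)
| And of formula & formula.

(* [(Gamma, C)] is the sequent Gamma |- C. *)
Definition sequent : Type := (seq formula * formula)%type.

Definition lang (Sigma : Type) : Type := set (seq Sigma).

Definition lang1 {Sigma : Type} : lang Sigma := [set [::]].

Definition langM (Sigma : Type) (X Y : lang Sigma) : lang Sigma :=
  [set u ++ v | u in X & v in Y].

Definition langX (Sigma : Type) (X : lang Sigma) (n : nat) : lang Sigma :=
  iter n (langM X) lang1.

Definition lang_star (Sigma : Type) (X : lang Sigma) : lang Sigma :=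
  \bigcup_(n in [set: nat]) langX X n.

Inductive regexp (Sigma : Type) : Type :=
| RLetter of Sigma
| RZero
| ROne
| RProd of regexp Sigma & regexp Sigma
| RUnion of regexp Sigma & regexp Sigma
| RStar of regexp Sigma.

Fixpoint re_lang (Sigma : Type) (e : regexp Sigma) : lang Sigma :=
  match e with
  | RLetter a => [set [:: a]]
  | RZero => set0
  | ROne => lang1
  | RProd e1 e2 => langM (re_lang e1) (re_lang e2)
  | RUnion e1 e2 => re_lang e1 `|` re_lang e2
  | RStar e1 => lang_star (re_lang e1)
  end.

Definition regular (Sigma : Type) (X : lang Sigma) : Prop :=
  exists e : regexp Sigma, re_lang e = X.

Definition interp (Sigma : Type) : Type := formula -> lang Sigma.

Definition Leps_model (Sigma : Type) (w : interp Sigma) : Prop :=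
  [/\ forall A B, w (LDiv A B) = [set u | forall v, w A v -> w B (v ++ u)],
      forall A B, w (And A B) = w A `&` w B
    & w One = [set [::]]].

Definition Lregeps_model (Sigma : Type) (w : interp Sigma) : Prop :=
  [/\ finite_set [set: Sigma], Leps_model w & forall i, regular (w (Var i))].

Definition true_in (Sigma : Type) (w : interp Sigma) (s : sequent) : Prop :=
  let: (Gamma, C) := s in
  match Gamma with
  | [::] => w C [::]
  | _ :: _ => foldr (@langM Sigma) lang1 (map w Gamma) `<=` w C
  end.

Definition Th (K : forall Sigma : Type, interp Sigma -> Prop) : set sequent :=
  [set s | forall (Sigma : Type) (w : interp Sigma), K Sigma w -> true_in w s].

(* Main.v *)
Require Import Defs.
From mathcomp Require Import all_boot.
From mathcomp Require Import boolp classical_sets cardinality.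

(** The separating sequent says that, for languages [A], [B], [L], the inclusions
    [B <= L], [A L B <= L], [A \ L <= L], [(A \ L) A <= L], [(B \ L) B <= L] and
    [B \ (A \ L) <= L] force the empty word into [L]; each inclusion [P <= Q] is
    expressed by [1 /\ (P \ Q)], which denotes [{eps}] or the empty language.
    It fails over [{a, b}] for [A = {a}], [B = {b}] and [L] the words with
    more [b]s than [a]s.  In general [A^n B^(n+1) <= L] for all [n]; if [L] is
    regular it has finitely many left quotients, so pumping yields
    [A^m B^(n+1) <= L] for some [m > n].  The rotations [(A \ L) A <= L] and
    [(B \ L) B <= L] bring a pair [A B] to the front, where it can be cancelled;
    this leaves [A^k <= L], and then [eps] in [L]. *)

Set Implicit Arguments.
Unset Strict Implicit.
Unset Printing Implicit Defensive.

Local Open Scope classical_set_scope.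

(** * Languages *)

Definition langD (Sigma : Type) (X Y : lang Sigma) : lang Sigma :=
  [set u | forall v, X v -> Y (v ++ u)].

Section Languages.
Variable Sigma : Type.
Implicit Types (X Y Z : lang Sigma) (u v : seq Sigma).

Lemma langM1 X : langM X lang1 = X.
Proof.
apply/seteqP; split=> [_ [u Xu [_ -> <-]] | u Xu]; first by rewrite cats0.
by exists u => //; exists [::] => //; rewrite cats0.
Qed.

Lemma lang1M X : langM lang1 X = X.
Proof.
apply/seteqP; split=> [_ [_ -> [u Xu <-]] // | u Xu].
by exists [::] => //; exists u.
Qed.

Lemma langMA X Y Z : langM X (langM Y Z) = langM (langM X Y) Z.
Proof.
apply/seteqP; split=> [_ [x Xx [_ [y Yy [z Zz <-]] <-]] |
                       _ [_ [x Xx [y Yy <-]] [z Zz <-]]].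
  by exists (x ++ y); [exists x => //; exists y | exists z; rewrite -?catA].
by exists x => //; exists (y ++ z); [exists y => //; exists z | rewrite catA].
Qed.

Lemma langXS X n : langX X n.+1 = langM X (langX X n).
Proof. by []. Qed.

Lemma langXSr X n : langX X n.+1 = langM (langX X n) X.
Proof.
elim: n => [|n IHn]; first by rewrite /langX /= lang1M langM1.
by rewrite langXS {1}IHn langMA.
Qed.

Lemma langDP X Y Z : langM X Y `<=` Z <-> Y `<=` langD X Z.
Proof.
split=> [XYZ y Yy x Xx | YXZ _ [x Xx [y Yy <-]]]; last exact: YXZ.
by apply: XYZ; exists x => //; exists y.
Qed.

Lemma subset_langMl X Y Z : X `<=` Y -> langM X Z `<=` langM Y Z.
Proof. by move=> XY _ [x /XY Yx [z Zz <-]]; exists x => //; exists z. Qed.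

Lemma subset_langMr X Y Z : X `<=` Y -> langM Z X `<=` langM Z Y.
Proof. by move=> XY _ [z Zz [x /XY Yx <-]]; exists z => //; exists x. Qed.

End Languages.

(** * Regular languages have finitely many left quotients *)

(** The fibres of [h] refine the Myhill-Nerode equivalence of [X], so [T] bounds the number of left
    quotients. *)
Definition finite_index (Sigma : Type) (X : lang Sigma) : Prop :=
  exists (T : finType) (h : seq Sigma -> T),
    forall u u', h u = h u' -> forall v, X (u ++ v) -> X (u' ++ v).

Section FiniteIndex.
Variable Sigma : Type.
Implicit Types (X Y Z : lang Sigma) (u v : seq Sigma).

(** Levi's lemma: [w] is the segment between the two cuts. *)
Lemma cat_eq_cat u v x y : u ++ v = x ++ y ->
  (exists w, x = u ++ w /\ v = w ++ y) \/ (exists w, u = x ++ w /\ y = w ++ v).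
Proof.
elim: u x => [|a u IHu] [|b x] /=.
- by move=> ->; left; exists [::].
- by move=> ->; left; exists (b :: x).
- by move=> <-; right; exists (a :: u).
case=> <- /IHu [[w [-> ->]]|[w [-> ->]]]; first by left; exists w.
by right; exists w.
Qed.

(* The quotient [u \ (X Y)] is the union of [(u \ X) Y] and of the [u2 \ Y] for
   [u = u1 u2] with [u1] in [X], so it depends only on the class of [u] for [X]
   and on this finite set of classes for [Y]. *)
Definition residual_classes X (T : finType) (h : seq Sigma -> T) u : {set T} :=
  [set t | `[< exists u1 u2, [/\ u = u1 ++ u2, X u1 & h u2 = t] >]]%SET.

Lemma residual_classesP X (T : finType) (h : seq Sigma -> T) u1 u2 u' :
  residual_classes X h (u1 ++ u2) = residual_classes X h u' -> X u1 ->
  exists u1' u2', [/\ u' = u1' ++ u2', X u1' & h u2' = h u2].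
Proof.
move=> /setP /(_ (h u2)); rewrite !inE => E Xu1.
by apply/asboolP; rewrite -E; apply/asboolP; exists u1, u2.
Qed.

Lemma finite_index0 : finite_index (set0 : lang Sigma).
Proof. by exists unit, (fun=> tt). Qed.

Lemma finite_index1 : finite_index (lang1 : lang Sigma).
Proof.
exists bool, (@nilp Sigma) => u u' E v /= /(congr1 size).
rewrite size_cat => /eqP; rewrite addn_eq0 => /andP[u0 /eqP/size0nil ->].
by rewrite cats0; apply: size0nil; apply/eqP; rewrite -[_ == _]E.
Qed.

Lemma finite_index_letter (a : Sigma) : finite_index [set [:: a]].
Proof.
(* Three classes occur: the empty word, the letter itself, and the words with no continuation in the
   language. *)
exists (bool * bool)%type, (fun u => (nilp u, `[< u = [:: a] >])).
move=> [|b u] u' [/esym u'0 E] v /=; first by move/eqP/size0nil: u'0 => ->.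
case=> ba; case: u E {u'0} => //= E v0; rewrite v0 cats0.
by apply/asboolP; rewrite -E ba; apply/asboolP.
Qed.

Lemma finite_indexU X Y :
  finite_index X -> finite_index Y -> finite_index (X `|` Y).
Proof.
move=> [T [h hP]] [T' [h' hP']].
exists (T * T')%type, (fun u => (h u, h' u)) => u u' [E E'] v [Xuv|Yuv].
  by left; apply: hP E _ Xuv.
by right; apply: hP' E' _ Yuv.
Qed.

Lemma finite_indexM X Y :
  finite_index X -> finite_index Y -> finite_index (langM X Y).
Proof.
move=> [T [h hP]] [T' [h' hP']].
exists (T * {set T'})%type, (fun u => (h u, residual_classes X h' u)).
move=> u u' [E E'] v [x Xx [y Yy]] /esym /cat_eq_cat.
case=> [[w [xE ->]]|[w [uE yE]]].
  rewrite catA; exists (u' ++ w); last by exists y.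
  by apply: hP E _ _; rewrite -xE.
have [u1 [u2 [-> Xu1 hu2]]] : exists u1 u2, [/\ u' = u1 ++ u2, X u1 & h' u2 = h' w].
  by apply: (residual_classesP _ Xx); rewrite -uE.
exists u1 => //; exists (u2 ++ v); last by rewrite catA.
by apply: hP' (esym hu2) _ _; rewrite -yE.
Qed.

Lemma lang_star_cat X x y : lang_star X x -> lang_star X y -> lang_star X (x ++ y).
Proof.
move=> [n _ Xnx] Xy; elim: n x Xnx => [_ -> //|n IHn _ [u Xu [v /IHn Xvy <-]]].
by have [m _ Xm] := Xvy; exists m.+1 => //; exists u => //; exists (v ++ y); rewrite ?catA.
Qed.

Lemma lang_star1 X x : X x -> lang_star X x.
Proof. by move=> Xx; exists 1 => //; exists x => //; exists [::]; rewrite ?cats0. Qed.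

(** The word [u2 ++ v1] is the factor from [X] that straddles the cut, or ends at it. *)
Lemma lang_star_split X u v : ~~ nilp u -> lang_star X (u ++ v) ->
  exists u1 u2 v1 v2, [/\ u = u1 ++ u2, v = v1 ++ v2, lang_star X u1,
                          X (u2 ++ v1) & lang_star X v2].
Proof.
move=> + [n _]; elim: n u => [|n IHn] u u0; first by case: u u0.
move=> [x Xx [y Xy]] /esym /cat_eq_cat [[w [xE vE]]|[w [uE yE]]].
  by exists [::], u, w, y; split=> //; [exists 0 | rewrite -xE | exists n].
have [w0|w0] := boolP (nilp w).
  exists [::], u, [::], v; split=> //; first by exists 0.
    by rewrite cats0 uE (size0nil (eqP w0)) cats0.
  by exists n => //; rewrite (size0nil (eqP w0)) in yE; rewrite -[v]yE.
have [|u1 [u2 [v1 [v2 [wE -> Xu1 Xuv Xv2]]]]] := IHn w w0; first by rewrite -yE.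
exists (x ++ u1), u2, v1, v2; split=> //; first by rewrite uE wE catA.
by apply: lang_star_cat => //; apply: lang_star1.
Qed.

(** The flag [nilp u] isolates the empty prefix, for which no straddling factor need exist. *)
Lemma finite_index_star X : finite_index X -> finite_index (lang_star X).
Proof.
move=> [T [h hP]].
exists (bool * {set T})%type, (fun u => (nilp u, residual_classes (lang_star X) h u)).
move=> u u' [E E'] v; have [u0|u0] := boolP (nilp u).
  by have:= u0; rewrite E; move: u0 => /eqP/size0nil-> /eqP/size0nil->.
move=> /(lang_star_split u0) [u1 [u2 [v1 [v2 [uE -> Xu1 Xuv Xv2]]]]].
have [u1' [u2' [-> Xu1' hu2]]] : exists u1' u2',
    [/\ u' = u1' ++ u2', lang_star X u1' & h u2' = h u2].
  by apply: (residual_classesP _ Xu1); rewrite -uE.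
rewrite -catA; apply: lang_star_cat => //; rewrite catA; apply: lang_star_cat => //.
by apply: lang_star1; apply: hP (esym hu2) _ Xuv.
Qed.

Lemma regular_finite_index X : regular X -> finite_index X.
Proof.
case=> e <-; elim: e => [a|||e1 IH1 e2 IH2|e1 IH1 e2 IH2|e IHe] /=.
- exact: finite_index_letter.
- exact: finite_index0.
- exact: finite_index1.
- exact: finite_indexM.
- exact: finite_indexU.
- exact: finite_index_star.
Qed.

(** Whether [P n] times [Y] lies in [X] depends only on the set [G n] of classes met by [P n]; the
    pigeonhole principle on subsets of [T] gives a repetition. *)
Lemma finite_index_pump X (P : nat -> lang Sigma) : finite_index X ->
  exists n m, n < m /\ forall Y, langM (P n) Y `<=` X -> langM (P m) Y `<=` X.
Proof.
move=> [T [h hP]].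
pose G n : {set T} := [set t | `[< exists2 x, P n x & h x = t >]]%SET.
have [n [m [nm Gnm]]] : exists n m, n < m /\ G n = G m.
  have /injectivePn [i [j ij Gij]] :
      ~~ injectiveb (fun i : 'I_#|{set T}|.+1 => G i).
    apply/negP => /injectiveP /leq_card; by rewrite card_ord ltnn.
  by have [] := ltngtP i j => [lt|lt|/val_inj/eqP]; [exists i, j | exists j, i |
    rewrite (negPf ij)].
exists n, m; split=> // Y PnY _ [x Px [y Yy <-]].
have [x' Px' hx'] : exists2 x', P n x' & h x' = h x.
  have /setP/(_ (h x)) := Gnm; rewrite !inE => E.
  by apply/asboolP; rewrite E; apply/asboolP; exists x.
by apply: hP hx' _ _; apply: PnY; exists x' => //; exists y.
Qed.

End FiniteIndex.

(** * The separating sequent *)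

Section Cancellation.
Variables (Sigma : Type) (A B L : lang Sigma).

(** One copy of [C] moves at a time: [C K <= L] means [K <= C \ L], hence
    [K C <= (C \ L) C <= L]. *)
Lemma langX_rotate (C : lang Sigma) : langM (langD C L) C `<=` L ->
  forall n K, langM (langX C n) K `<=` L -> langM K (langX C n) `<=` L.
Proof.
move=> rotC; elim=> [|n IHn] K; first by rewrite langM1 lang1M.
rewrite langXS -langMA => /langDP CnK.
rewrite langMA; apply: IHn; rewrite langMA.
exact: subset_trans (subset_langMl CnK) rotC.
Qed.

Hypotheses (LB : B `<=` L) (LALB : langM A (langM L B) `<=` L).
Hypotheses (popA : langD A L `<=` L) (popAB : langD B (langD A L) `<=` L).
Hypotheses (rotA : langM (langD A L) A `<=` L) (rotB : langM (langD B L) B `<=` L).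

Lemma langX_unbalanced n : langM (langX A n) (langX B n.+1) `<=` L.
Proof.
elim: n => [|n IHn]; first by rewrite lang1M [langX B 1]langM1.
rewrite (langXSr B) (langXS A) -langMA (langMA (langX A n)).
exact: subset_trans (subset_langMr (subset_langMl IHn)) LALB.
Qed.

Lemma langX_cancel n m : n <= m -> langM (langX A m) (langX B n) `<=` L -> L [::].
Proof.
elim: n m => [|n IHn] m.
  move=> _; rewrite langM1; elim: m => [|m IHm]; first by apply.
  by move=> /langDP Am; apply: IHm; apply: subset_trans popA.
(* Rotating [A^m] to the back gives [A B B^n A^m]; [popAB] removes [A B], and rotating [B^n] leaves
   [A^m B^n]. *)
case: m => // m nm; rewrite (langXSr A) -langMA => /(langX_rotate rotA).
rewrite -!langMA => /langDP/langDP AB; apply: (IHn m nm).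
by apply: (langX_rotate rotB); apply: subset_trans popAB.
Qed.

Lemma regular_contains_eps : regular L -> L [::].
Proof.
move=> /regular_finite_index /(finite_index_pump (langX A)) [n [m [nm pump]]].
(* With [Y = B^(n+1)], the strict inequality [n < m] is exactly the bound [n+1 <= m] that
   cancellation requires. *)
by apply: (langX_cancel nm); apply: pump; apply: langX_unbalanced.
Qed.

End Cancellation.

(** Without a product connective, inclusions of products are curried: [A L B <= L] becomes
    [B <= L \ (A \ L)]. *)
Definition separating_sequent : sequent :=
  let A := Var 0 in let B := Var 1 in let L := Var 2 in
  ([:: And One (And (LDiv B L) (And (LDiv B (LDiv L (LDiv A L)))
      (And (LDiv (LDiv A L) L) (And (LDiv (LDiv B (LDiv A L)) L)
      (And (LDiv A (LDiv (LDiv A L) L)) (LDiv B (LDiv (LDiv B L) L)))))))],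
   L).

Lemma separating_sequentP (Sigma : Type) (w : interp Sigma) : Leps_model w ->
  let A := w (Var 0) in let B := w (Var 1) in let L := w (Var 2) in
  true_in w separating_sequent <->
  (B `<=` L -> langM A (langM L B) `<=` L -> langD A L `<=` L ->
   langD B (langD A L) `<=` L -> langM (langD A L) A `<=` L ->
   langM (langD B L) B `<=` L -> L [::]).
Proof.
move=> [wD wI w1] A B L.
have epsD X Y : langD X Y [::] <-> X `<=` Y.
  by split=> XY x /XY; rewrite cats0.
have wDE F G : w (LDiv F G) = langD (w F) (w G) by rewrite wD.
rewrite /true_in /separating_sequent [foldr _ _ _]langM1 !wI !wDE w1 -/A -/B -/L.
split=> [sub h1 h2 h3 h4 h5 h6|imp _ [-> [h1 [h2 [h3 [h4 [h5 h6]]]]]]].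
  apply: sub; split=> //; split; first exact/epsD.
  split; first by apply/epsD; move: h2 => /langDP/langDP.
  split; first exact/epsD; split; first exact/epsD.
  by split; exact/epsD/langDP.
apply: imp; [exact/epsD | exact/langDP/langDP/epsD | exact/epsD | exact/epsD |
  exact/langDP/epsD | exact/langDP/epsD].
Qed.

Fixpoint interp_of (Sigma : Type) (f : nat -> lang Sigma) (F : formula) : lang Sigma :=
  match F with
  | Var i => f i
  | One => lang1
  | LDiv F G => langD (interp_of f F) (interp_of f G)
  | And F G => interp_of f F `&` interp_of f G
  end.

Lemma interp_of_Leps_model (Sigma : Type) (f : nat -> lang Sigma) :
  Leps_model (interp_of f).
Proof. by []. Qed.

(* The letter [a] is [true] and [b] is [false]. *)
Definition counterexample (i : nat) : lang bool :=
  match i with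
  | 0 => [set [:: true]]
  | 1 => [set [:: false]]
  | _ => [set u | count_mem true u < count_mem false u]
  end.

Lemma counterexample_refutes :
  ~ true_in (interp_of counterexample) separating_sequent.
Proof.
move=> /(separating_sequentP (interp_of_Leps_model _)) /= H.
have: [set u | count_mem true u < count_mem false u] [::]; last by [].
(* Membership depends only on letter counts: adding or removing a pair [a], [b] keeps the excess of
   [b], removing an [a] raises it, and a rotation permutes letters. *)
apply: H.
- by move=> _ ->.
- by move=> _ [_ -> [_ [l Ll [_ -> <-]] <-]] /=; rewrite !count_cat /= add0n add1n addn0 addn1; exact: Ll.
- by move=> u /(_ _ erefl) /= /ltnW.
- by move=> u /(_ _ erefl _ erefl).
- move=> _ [u /(_ _ erefl) /= Lu [_ -> <-]] /=.
  by rewrite !count_cat /= !addn0 addn1.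
- move=> _ [u /(_ _ erefl) /= Lu [_ -> <-]] /=.
  by rewrite !count_cat /= !addn0 addn1.
Qed.

Theorem theorem17 : Th (@Lregeps_model) <> Th (@Leps_model).
Proof.
move=> ThE; apply: counterexample_refutes.
suff : Th (@Leps_model) separating_sequent by apply; apply: interp_of_Leps_model.
rewrite -ThE => Sigma w [_ wL wreg]; apply/(separating_sequentP wL).
by move=> *; apply: (@regular_contains_eps _ (w (Var 0)) (w (Var 1))).
Qed.
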